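(* Let $\phi$ and $B$ satisfy the slowly varying moment class assumption stated in the context, and let $r(\Delta)$ and $m(\Delta)$ be as defined there. Then $r(\Delta)\sim m(\Delta)$ as $\Delta\downarrow0$, i.e. $r(\Delta)/m(\Delta)\to1$.
   Context: Slowly varying moment class assumption: $\phi:\mathbb R\to[0,\infty)$ is even, continuous, non-decreasing on $[0,\infty)$, $\phi(x)/|x|\to\infty$ as $|x|\to\infty$, $\phi(0)<B$, and (A1) there is $x_0>0$ with $\phi(x)=0$ for $|x|\le x_0$; (A2) with $\Lambda(x)=\phi(x)/|x|$, there exist $x_\infty>1$, $\Lambda_0>0$ and a continuously differentiable $\eta:[x_\infty,\infty)\to(0,\infty)$ such that $\Lambda(x)=\Lambda_0\exp\{\int_{x_\infty}^x\frac{\eta(u)}{u}\,du\}$ for $x\ge x_\infty$, where (i) $\eta(x)\to0$; (ii) $\int_{x_\infty}^\infty\frac{\eta(u)}{u}\,du=\infty$; (iii) $x\eta'(x)/\eta(x)\to0$ as $x\to\infty$. Then $\Lambda$ is a strictly increasing continuous bijection of $[x_\infty,\infty)$ onto $[\Lambda(x_\infty),\infty)$, with inverse $\Lambda^{-1}$. For $\Delta>0$ small enough that $B/\Delta\ge\Lambda(x_\infty)$ set $a(\Delta)=\Lambda^{-1}(B/\Delta)$ and $m(\Delta)=\Delta/a(\Delta)$. For $\mu\in\mathbb R$, $\mathcal C_\mu$ is the set of Borel probability measures $P$ on $\mathbb R$ with $\int x\,dP=\mu$ and $\int\phi(x-\mu)\,dP\le B$. $r(\Delta):=-\log\sup\{\rho(P_-,P_+):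 P_-\in\mathcal C_{-\Delta},\,P_+\in\mathcal C_{\Delta}\}$, where $\rho(P_-,P_+)=\int\sqrt{dP_-\,dP_+}$ is the Hellinger affinity (computed with densities with respect to any common dominating measure). *)

(* Defs.v *)
From HB Require Import structures.
From mathcomp Require Import all_boot all_order all_algebra.
From mathcomp Require Import all_classical all_reals all_analysis.
From mathcomp Require Import measurable_realfun.

Set Implicit Arguments.
Unset Strict Implicit.
Unset Printing Implicit Defensive.

Import Order.TTheory GRing.Theory Num.Theory.
Import numFieldNormedType.Exports.

Local Open Scope classical_set_scope.
Local Open Scope ring_scope.
Local Open Scope charge_scope.

Definition sum_measure d (T : measurableType d) (R : realType)
  (P Q : probability T R) : set T -> \bar R := measure_add P Q.

Section sum_measure_instances.
Context d (T : measurableType d) (R : realType) (P Q : probability T R).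

HB.instance Definition _ := Measure.on (sum_measure P Q).

Let sum_measure_fin : fin_num_fun (sum_measure P Q).
Proof.
move=> A mA; rewrite /sum_measure measure_addE fin_numD.
by rewrite !fin_num_measure.
Qed.

HB.instance Definition _ :=
  @Measure_isFinite.Build _ T R (sum_measure P Q) sum_measure_fin.

End sum_measure_instances.

(* The densities are taken with respect to the dominating measure P + Q;
   [hellinger_affinityE] below shows that any other sigma-finite dominating
   measure gives the same value. *)
Definition hellinger_affinity d (T : measurableType d) (R : realType)
    (P Q : probability T R) : R :=
  \int[sum_measure P Q]_x
    Num.sqrt (fine (('d (charge_of_finite_measure P) '/d (sum_measure P Q)) x)
            * fine (('d (charge_of_finite_measure Q) '/d (sum_measure P Q)) x)).

Lemma density_chain d (T : measurableType d) (R : realType)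
    (P : probability T R) (lam : {finite_measure set T -> \bar R})
    (nu : {sigma_finite_measure set T -> \bar R}) (p : T -> R) :
  measurable_fun setT p -> (forall x, 0 <= p x) ->
  P `<< lam -> lam `<< nu ->
  (forall A, measurable A -> P A = (\int[nu]_(x in A) (p x)%:E)%E) ->
  {ae nu, forall x, p x = fine (('d (charge_of_finite_measure P) '/d lam) x)
            * fine (Radon_Nikodym_SigmaFinite.f lam nu x)}.
Proof.
move=> mp p0 Plam lamnu PE.
have Pnu : P `<< nu by exact: null_dominates_trans lamnu.
have ip : nu.-integrable setT (EFin \o p).
  apply/integrableP; split; first exact/measurable_EFinP.
  under eq_integral do rewrite gee0_abs ?lee_fin//.
  by rewrite -PE// probability_setT ltry.
have H1 : ae_eq nu setT (EFin \o p) ('d (charge_of_finite_measure P) '/d nu).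
  apply: integral_ae_eq => // A _ mA.
  by rewrite -Radon_Nikodym_integral// -PE.
have H2 := @Radon_Nikodym_chain_rule _ _ _
  (charge_of_finite_measure P) nu lam Plam lamnu.
have H3 := @ae_eq_Radon_Nikodym_SigmaFinite _ _ _ lam nu lamnu setT measurableT.
move: H1 H2 H3; apply: filterS3 => x /(_ I) /= h1 /(_ I) /= h2 /(_ I) h3.
have : (p x)%:E = (('d (charge_of_finite_measure P) '/d lam) x *
          Radon_Nikodym_SigmaFinite.f lam nu x)%E by rewrite h1 h2 h3.
move/(congr1 fine) => /= ->; rewrite fineM//.
- exact: Radon_Nikodym_fin_num.
- exact: Radon_Nikodym_SigmaFinite.f_fin_num.
Qed.

Lemma hellinger_affinityE d (T : measurableType d) (R : realType)
    (P Q : probability T R) (nu : {sigma_finite_measure set T -> \bar R})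
    (p q : T -> R) :
  measurable_fun setT p -> measurable_fun setT q ->
  (forall x, 0 <= p x) -> (forall x, 0 <= q x) ->
  (forall A, measurable A -> P A = (\int[nu]_(x in A) (p x)%:E)%E) ->
  (forall A, measurable A -> Q A = (\int[nu]_(x in A) (q x)%:E)%E) ->
  hellinger_affinity P Q = \int[nu]_x Num.sqrt (p x * q x).
Proof.
move=> mp mq p0 q0 PE QE; rewrite /hellinger_affinity /Rintegral; congr fine.
set lam := (sum_measure P Q : {finite_measure set T -> \bar R}).
have lamE A : lam A = (P A + Q A)%E by rewrite /lam /= /sum_measure measure_addE.
have Plam : P `<< lam.
  apply/null_content_dominatesP => A mA lamA0.
  by have /esym/eqP := lamE A; rewrite [lam A]lamA0 padde_eq0// => /andP[/eqP].
have Qlam : Q `<< lam.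
  apply/null_content_dominatesP => A mA lamA0.
  by have /esym/eqP := lamE A; rewrite [lam A]lamA0 padde_eq0// => /andP[_ /eqP].
have lamnu : lam `<< nu.
  apply/null_content_dominatesP => A mA nuA.
  rewrite [LHS]lamE PE// QE// !null_set_integral ?adde0//;
    exact/measurable_funTS/measurable_EFinP.
set f := Radon_Nikodym _ _; set g := Radon_Nikodym _ _.
have mfn (u : T -> \bar R) : measurable_fun setT u ->
    measurable_fun setT (fine \o u).
  by move=> mu; exact: measurableT_comp.
have mf : measurable_fun setT (fine \o f).
  by apply: mfn; exact/measurable_int/Radon_Nikodym_integrable.
have mg : measurable_fun setT (fine \o g).
  by apply: mfn; exact/measurable_int/Radon_Nikodym_integrable.
have msq (u v : T -> R) : measurable_fun setT u -> measurable_fun setT v ->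
    measurable_fun setT (fun x => (Num.sqrt (u x * v x))%:E).
  move=> mu mv; apply/measurable_EFinP.
  apply: (@measurableT_comp _ _ _ _ _ _ (@Num.sqrt R)) => //.
    apply: continuous_measurable_fun; exact: sqrt_continuous.
  exact: measurable_funM.
have sq0 x : (0 <= (Num.sqrt (fine (f x) * fine (g x)))%:E)%E.
  by rewrite lee_fin sqrtr_ge0.
have := Radon_Nikodym_SigmaFinite.change_of_variables lamnu sq0 measurableT
  (msq _ _ mf mg).
move=> <-.
have mh : measurable_fun setT (Radon_Nikodym_SigmaFinite.f lam nu).
  exact/measurable_int/Radon_Nikodym_SigmaFinite.f_integrable.
apply: ae_eq_integral => //.
- by apply: emeasurable_funM => //; exact: (msq _ _ mf mg).
- exact: msq.
have H1 := density_chain mp p0 Plam lamnu PE.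
have H2 := density_chain mq q0 Qlam lamnu QE.
move: H1 H2; apply: filterS2 => x h1 h2 _; rewrite h1 h2.
set h := Radon_Nikodym_SigmaFinite.f lam nu x.
have h0 : 0 <= fine h by apply/fine_ge0/Radon_Nikodym_SigmaFinite.f_ge0.
have <- : (fine h)%:E = h by rewrite fineK// Radon_Nikodym_SigmaFinite.f_fin_num.
rewrite -EFinM /= mulrACA -expr2 [X in _ = (Num.sqrt X)%:E]mulrC; congr EFin.
by rewrite [RHS]sqrtrM ?sqr_ge0// sqrtr_sqr ger0_norm// mulrC.
Qed.

Definition Lambda (R : realType) (phi : R -> R) (x : R) : R := phi x / `|x|.

(* [eta] is a total function of which only the values on [xoo, +oo[ matter;
   [deta] is its derivative on that half-line, one-sided at [xoo]. *)
Definition C1_on_half_line (R : realType) (xoo : R) (eta deta : R -> R) : Prop :=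
  (forall x, xoo <= x ->
     (eta y - eta x) / (y - x) @[y --> within `[xoo, +oo[ x^'] --> deta x) /\
  {within `[xoo, +oo[, continuous deta}.

Record slowly_varying_representation (R : realType) (phi : R -> R)
    (xoo Lambda0 : R) (eta : R -> R) : Prop := SlowlyVaryingRepresentation {
  svr_xoo_gt1 : 1 < xoo ;
  svr_Lambda0_gt0 : 0 < Lambda0 ;
  svr_eta_gt0 : forall x, xoo <= x -> 0 < eta x ;
  svr_LambdaE : forall x, xoo <= x ->
    Lambda phi x =
      Lambda0 * expR (\int[lebesgue_measure]_(u in `[xoo, x]) (eta u / u)) ;
  svr_eta_cvg0 : eta x @[x --> +oo] --> 0 ;
  svr_integral_eta :
    (\int[lebesgue_measure]_(u in `[xoo, +oo[) (eta u / u)%:E = +oo)%E ;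
  svr_deta : exists deta : R -> R,
    C1_on_half_line xoo eta deta /\
    x * deta x / eta x @[x --> +oo] --> 0 }.

Record slowly_varying_moment_class (R : realType) (phi : R -> R)
    (B xoo Lambda0 : R) (eta : R -> R) : Prop := SlowlyVaryingMomentClass {
  svmc_phi_ge0 : forall x, 0 <= phi x ;
  svmc_phi_even : forall x, phi (- x) = phi x ;
  svmc_phi_continuous : continuous phi ;
  svmc_phi_ndecr : {in `[0, +oo[ &, {homo phi : x y / x <= y}} ;
  svmc_phi_superlinear_pinfty : phi x / `|x| @[x --> +oo] --> +oo ;
  svmc_phi_superlinear_ninfty : phi x / `|x| @[x --> -oo] --> +oo ;
  svmc_phi0_ltB : phi 0 < B ;
  svmc_A1 : exists x0 : R, 0 < x0 /\ (forall x, `|x| <= x0 -> phi x = 0) ;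
  svmc_A2 : slowly_varying_representation phi xoo Lambda0 eta }.

(* [a_ phi B xoo Delta] is the inverse at B / Delta of Lambda restricted to
   [xoo, +oo[; its value is irrelevant when B / Delta < Lambda xoo. *)
Definition a_ (R : realType) (phi : R -> R) (B xoo Delta : R) : R :=
  'pinv_(fun=> 0) `[xoo, +oo[ (Lambda phi) (B / Delta).

Definition m_ (R : realType) (phi : R -> R) (B xoo Delta : R) : R :=
  Delta / a_ phi B xoo Delta.

Definition moment_class (R : realType) (phi : R -> R) (B mu : R) :
    set (probability (measurableTypeR R) R) :=
  [set P | [/\ P.-integrable setT (fun x : R => x%:E),
               (\int[P]_x x%:E = mu%:E)%E &
               (\int[P]_x (phi (x - mu))%:E <= B%:E)%E]].

(* Affinities lie in [0, 1], and the set is nonempty when phi 0 <= B (Dirac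
   masses at -Delta and Delta), so [sup] is a genuine supremum. *)
Definition r_ (R : realType) (phi : R -> R) (B Delta : R) : R :=
  - ln (sup [set hellinger_affinity Pm Pp
            | Pm in moment_class phi B (- Delta) &
              Pp in moment_class phi B Delta]).

(* Main.v *)
(** Write [a = a(Delta)] and [m = Delta / a].  The two-point laws
    [(1 - m) delta_0 + m delta_a] and [(1 - m) delta_0 + m delta_(-a)] are
    admissible and have affinity at least [1 - m], so [r <= m / (1 - m)].

    Conversely, if [u v >= 1] pointwise then
    [rho <= (\int u dP_- + \int v dP_+) / 2].  With
    [u = c + l phi (x + Delta) + k x] and [v = c + l phi (x - Delta) - k x] this
    gives [rho <= c + l B - k Delta], subject to
    [c + l phi y >= sqrt (1 + k^2 (y + Delta)^2)] for all [y >= 0].  Up to a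
    factor [1 - d], take [l = 1 / (a Lambda(a) eta(a))] and
    [k = (1 + eta(a)) / (a eta(a))], for which [k Delta - l B = m] exactly, and
    let [c - 1] be of smaller order than [m].  Slow variation of [Lambda] and
    [eta] yields the constraint: [Lambda] lies above its tangent in the variable
    [1 / x] at [a], which covers [y >= a eta(a) / 16], while [Lambda(y) / y] is
    nonincreasing, which covers the smaller [y]; bounded [y] are absorbed by
    [c]. *)
From HB Require Import structures.
Require Import Defs.
From mathcomp Require Import all_boot all_order all_algebra.
From mathcomp Require Import all_classical all_reals all_analysis.
From mathcomp Require Import measurable_realfun ring lra.
Set Implicit Arguments.
Unset Strict Implicit.
Unset Printing Implicit Defensive.
Import Order.TTheory GRing.Theory Num.Theory.
Import numFieldNormedType.Exports.
Local Open Scope classical_set_scope.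
Local Open Scope ring_scope.
Local Open Scope charge_scope.

(** * Hellinger affinity through densities: bounds from above and below *)

Lemma density_of_dominated d (T : measurableType d) (R : realType)
    (N : probability T R) (lam : {finite_measure set T -> \bar R}) :
  N `<< lam -> exists p : T -> R,
    [/\ measurable_fun setT p, forall x, 0 <= p x,
     (forall A, measurable A -> N A = (\int[lam]_(x in A) (p x)%:E)%E) &
     forall f : T -> R, measurable_fun setT f -> (forall x, 0 <= f x) ->
       (\int[N]_x (f x)%:E = \int[lam]_x (f x * p x)%:E)%E].
Proof.
(* This version of the derivative is finite at every point, so passing to real values by [fine]
   loses nothing. *)
move=> Nlam; pose p := Radon_Nikodym_SigmaFinite.f N lam.
have pE x : (fine (p x))%:E = p x.
  by rewrite fineK// Radon_Nikodym_SigmaFinite.f_fin_num.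
have mp : measurable_fun setT p.
  exact/measurable_int/Radon_Nikodym_SigmaFinite.f_integrable.
exists (fine \o p); split.
- exact: measurableT_comp.
- by move=> x; exact/fine_ge0/Radon_Nikodym_SigmaFinite.f_ge0.
- move=> A mA; rewrite (Radon_Nikodym_SigmaFinite.f_integral Nlam)//.
  by apply: eq_integral => x _; rewrite /= pE.
- move=> f mf f0.
  rewrite -(Radon_Nikodym_SigmaFinite.change_of_variables Nlam)//.
  + by apply: eq_integral => x _; rewrite EFinM /= pE.
  + exact/measurable_EFinP.
Qed.

Lemma hellinger_affinity_density d (T : measurableType d) (R : realType)
    (P Q : probability T R) :
  exists (lam : {finite_measure set T -> \bar R}) (p q : T -> R),
  [/\ measurable_fun setT p, measurable_fun setT q, forall x, 0 <= p x &
      forall x, 0 <= q x] /\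
  [/\ (forall A, measurable A -> P A = (\int[lam]_(x in A) (p x)%:E)%E),
      (forall A, measurable A -> Q A = (\int[lam]_(x in A) (q x)%:E)%E),
      (forall f : T -> R, measurable_fun setT f -> (forall x, 0 <= f x) ->
        (\int[P]_x (f x)%:E = \int[lam]_x (f x * p x)%:E)%E),
      (forall f : T -> R, measurable_fun setT f -> (forall x, 0 <= f x) ->
        (\int[Q]_x (f x)%:E = \int[lam]_x (f x * q x)%:E)%E) &
      (hellinger_affinity P Q)%:E = (\int[lam]_x (Num.sqrt (p x * q x))%:E)%E].
Proof.
set lam := (sum_measure P Q : {finite_measure set T -> \bar R}).
have lamE A : lam A = (P A + Q A)%E by rewrite /lam /= /sum_measure measure_addE.
have Plam : (P `<< lam).
  apply/null_content_dominatesP => A mA lamA0.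
  by have /esym/eqP := lamE A; rewrite [lam A]lamA0 padde_eq0// => /andP[/eqP].
have Qlam : (Q `<< lam).
  apply/null_content_dominatesP => A mA lamA0.
  by have /esym/eqP := lamE A; rewrite [lam A]lamA0 padde_eq0// => /andP[_ /eqP].
have [p [mp p0 PE intP]] := density_of_dominated Plam.
have [q [mq q0 QE intQ]] := density_of_dominated Qlam.
exists lam, p, q; do 2!split => //.
rewrite (@hellinger_affinityE _ _ _ _ _ lam _ _ mp mq p0 q0 PE QE) fineK//.
have mpq : measurable_fun setT (fun x => (p x + q x)%:E).
  by apply/measurable_EFinP; exact: measurable_funD.
(* The affinity is finite because [sqrt (p q) <= p + q], whose integral is 2. *)
rewrite ge0_fin_numE; last first.
  by apply: integral_ge0 => x _; rewrite lee_fin sqrtr_ge0.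
apply: (@le_lt_trans _ _ (\int[lam]_x (p x + q x)%:E)%E); last first.
  under eq_integral do rewrite EFinD.
  rewrite ge0_integralD//; last 4 first.
  - by move=> x _; rewrite lee_fin.
  - exact/measurable_EFinP.
  - by move=> x _; rewrite lee_fin.
  - exact/measurable_EFinP.
  by rewrite -PE// -QE// !probability_setT ltry.
apply: ge0_le_integral => //.
- apply/measurable_EFinP.
  apply: (@measurableT_comp _ _ _ _ _ _ (@Num.sqrt R)) => //.
    by apply: continuous_measurable_fun; exact: sqrt_continuous.
  exact: measurable_funM.
move=> x _; rewrite lee_fin; have := p0 x; have := q0 x.
move: (p x) (q x) => a b b0 a0.
rewrite -(@ler_pXn2r _ 2)// ?nnegrE ?addr_ge0 ?sqrtr_ge0//.
by rewrite sqr_sqrtr ?mulr_ge0//; nra.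
Qed.

(** By AM-GM, [sqrt (p q) <= sqrt ((u p) (v q)) <= (u p + v q) / 2] when [u v >= 1]; integrating
    against the common dominating measure gives the bound. *)
Lemma hellinger_affinity_le d (T : measurableType d) (R : realType)
    (P Q : probability T R) (u v : T -> R) (K : R) :
  measurable_fun setT u -> measurable_fun setT v ->
  (forall x, 0 <= u x) -> (forall x, 0 <= v x) -> (forall x, 1 <= u x * v x) ->
  (\int[P]_x (u x)%:E + \int[Q]_x (v x)%:E <= (2 * K)%:E)%E ->
  hellinger_affinity P Q <= K.
Proof.
move=> mu mv u0 v0 uv1 uvK.
have [lam [p [q [[mp mq p0 q0] [_ _ intP intQ pqE]]]]] :=
  hellinger_affinity_density P Q.
rewrite -lee_fin {}pqE.
have -> : K = 2^-1 * (2 * K) by field.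
rewrite EFinM; apply: le_trans (lee_wpmul2l _ uvK); last by rewrite lee_fin.
rewrite intP// intQ// -ge0_integralD//; last 4 first.
- by move=> x _; rewrite lee_fin mulr_ge0.
- exact/measurable_EFinP/measurable_funM.
- by move=> x _; rewrite lee_fin mulr_ge0.
- exact/measurable_EFinP/measurable_funM.
rewrite -ge0_integralZl//; last 2 first.
- by apply: emeasurable_funD; exact/measurable_EFinP/measurable_funM.
- by move=> x _; rewrite -EFinD lee_fin addr_ge0// mulr_ge0.
apply: ge0_le_integral => //.
- apply/measurable_EFinP.
  apply: (@measurableT_comp _ _ _ _ _ _ (@Num.sqrt R)) => //.
    by apply: continuous_measurable_fun; exact: sqrt_continuous.
  exact: measurable_funM.
- apply/measurable_EFinP/measurable_funM => //.
  by apply: measurable_funD; exact: measurable_funM.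
move=> x _; rewrite -EFinD -EFinM lee_fin.
have := p0 x; have := q0 x; have := u0 x; have := v0 x; have := uv1 x.
move: (p x) (q x) (u x) (v x) => a b s t st1 t0 s0 b0 a0.
have ab0 : 0 <= s * a + t * b by rewrite addr_ge0// mulr_ge0.
rewrite -(@ler_pXn2r _ 2)// ?nnegrE ?sqrtr_ge0//; last by rewrite mulr_ge0.
rewrite sqr_sqrtr ?mulr_ge0//.
(* [(s a + t b)^2 = (s a - t b)^2 + 4 s t a b >= 4 a b]. *)
have : 0 <= a * b * (s * t - 1) by rewrite mulr_ge0 ?mulr_ge0// subr_ge0.
have := sqr_ge0 (s * a - t * b).
nra.
Qed.

(** A common atom contributes its full mass: at [x] both densities times [lam [set x]] equal [w],
    hence so does their geometric mean. *)
Lemma hellinger_affinity_ge_set1 d (T : measurableType d) (R : realType)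
    (P Q : probability T R) (x : T) (w : R) :
  measurable [set x] -> 0 <= w -> P [set x] = w%:E -> Q [set x] = w%:E ->
  w <= hellinger_affinity P Q.
Proof.
move=> mx w0 Px Qx.
have [lam [p [q [[mp mq p0 q0] [PE QE _ _ pqE]]]]] :=
  hellinger_affinity_density P Q.
have intx (f : T -> R) :
    (\int[lam]_(y in [set x]) (f y)%:E = (f x)%:E * lam [set x])%E.
  rewrite -integral_cst//; apply: eq_integral => y; rewrite inE => ->//.
have lamx : lam [set x] = (fine (lam [set x]))%:E.
  by rewrite fineK// fin_num_measure.
have l0 : 0 <= fine (lam [set x]) by rewrite fine_ge0.
have /esym := PE _ mx; have /esym := QE _ mx.
rewrite Px Qx !intx lamx -!EFinM => -[qw] [pw].
rewrite -lee_fin {}pqE.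
have -> : w%:E = (\int[lam]_(y in [set x]) (Num.sqrt (p y * q y))%:E)%E.
  rewrite intx lamx -EFinM; congr EFin.
  rewrite -{1}(ger0_norm w0) -sqrtr_sqr -[in RHS](ger0_norm l0) -sqrtr_sqr.
  rewrite -sqrtrM ?mulr_ge0//; congr Num.sqrt.
  by rewrite expr2 -{1}pw -qw; ring.
apply: ge0_subset_integral => //.
- apply/measurable_EFinP.
  apply: (@measurableT_comp _ _ _ _ _ _ (@Num.sqrt R)) => //.
    by apply: continuous_measurable_fun; exact: sqrt_continuous.
  exact: measurable_funM.
Qed.

(** * Moment classes: two-point laws and weak duality *)

(* The canonical measurable structure of [R], used by the integrals of
   [moment_class], and [measurableTypeR R] have the same measurable sets but
   different displays; integrals are transferred by pushing forward along the
   identity. *)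
Section borel_transfer.
Context {R : realType}.

Definition borel_id (x : measurableTypeR R) : R := x.

Lemma measurable_borel_id : measurable_fun setT borel_id.
Proof. by move=> _ A mA; rewrite setTI. Qed.

HB.instance Definition _ :=
  isMeasurableFun.Build _ _ _ _ borel_id measurable_borel_id.

Definition borel_law (P : probability (measurableTypeR R) R) : probability R R :=
  distribution P borel_id.

End borel_transfer.

Lemma exists_two_point_law (R : realType) (m a : R) : 0 <= m <= 1 -> a != 0 ->
  exists P : probability (measurableTypeR R) R,
  [/\ P [set 0] = (1 - m)%:E, (borel_law P).-integrable setT (fun x : R => x%:E),
      (\int[borel_law P]_x x%:E = (m * a)%:E)%E &
      forall f : R -> R, measurable_fun setT f -> (forall x, 0 <= f x) ->
        (\int[borel_law P]_x (f x)%:E = (m * f a + (1 - m) * f 0)%:E)%E].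
Proof.
(* The law is the image of a Bernoulli variable of parameter [m] under [b |-> a b]; since [a != 0],
   the atom at 0 comes from [false] alone. *)
move=> m01 a0; pose X (b : bool) : R := a * b%:R.
have mX : measurable_fun setT X by [].
pose XX : {mfun bool >-> R} := HB.pack X (isMeasurableFun.Build _ _ _ _ X mX).
have mY : measurable_fun setT (X : bool -> measurableTypeR R) by [].
pose Y : {mfun bool >-> measurableTypeR R} :=
  HB.pack (X : bool -> measurableTypeR R) (isMeasurableFun.Build _ _ _ _ _ mY).
pose D := distribution (bernoulli_prob m) XX.
have ib : (bernoulli_prob m).-integrable setT (fun b : bool => (b%:R : R)%:E).
  apply/integrableP; split; first by [].
  rewrite (integral_bernoulli_prob m01)// !abse_EFin ?normr1 ?normr0.
  by rewrite mule0 adde0 mule1 ltry.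
have iX : (bernoulli_prob m).-integrable setT (EFin \o X).
  by have := integrableZl measurableT a ib.
exists (distribution (bernoulli_prob m) Y).
suff [D0 iD meanD fD] : [/\ D [set 0] = (1 - m)%:E,
    D.-integrable setT (fun x : R => x%:E), (\int[D]_x x%:E = (m * a)%:E)%E &
    forall f : R -> R, measurable_fun setT f -> (forall x, 0 <= f x) ->
      (\int[D]_x (f x)%:E = (m * f a + (1 - m) * f 0)%:E)%E].
  by split; [exact: D0|exact: iD|exact: meanD|exact: fD].
split.
- rewrite /D /distribution /pushforward /= (_ : _ @^-1` _ = [set false]).
    rewrite bernoulli_probE// !diracE memNset// mem_set//=.
    by rewrite mule0 add0e mule1.
  apply/seteqP; split=> -[] //= => [/eqP|]; last by rewrite /X mulr0.
  by rewrite /X mulr1 (negbTE a0).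
- have mE : measurable_fun [set: R] (EFin : R -> \bar R) by exact/measurable_EFinP.
  exact: (integrable_pushforward mX mE iX measurableT).
- rewrite /D integral_distribution//.
  rewrite (eq_integral (fun b : bool => (a%:E * (b%:R : R)%:E)%E))//.
  rewrite integralZl// (integral_bernoulli_prob m01)//.
  by rewrite /= mule0 adde0 mule1 -EFinM mulrC.
- move=> f mf f0; rewrite /D ge0_integral_distribution//; last first.
    exact/measurable_EFinP.
  rewrite (integral_bernoulli_prob m01)//; last first.
    by move=> b; rewrite lee_fin.
  by rewrite /= /X mulr1 mulr0 -!EFinM -EFinD.
Qed.

(** Lagrangian side of the duality: the mean constraint is an equality, so its multiplier [s] may
    have either sign, while the moment bound needs [0 <= l]. *)
Lemma moment_class_integral_le (R : realType) (phi : R -> R) (B mu c l s : R)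
    (P : probability (measurableTypeR R) R) :
  (forall x, 0 <= phi x) -> continuous phi -> 0 <= l ->
  moment_class phi B mu P ->
  (\int[borel_law P]_x (c + l * phi (x - mu) + s * x)%:E <=
   (c + l * B + s * mu)%:E)%E.
Proof.
move=> phi0 cphi l0 [iid' mean' phiB'].
have iid : (borel_law P).-integrable setT (fun x : R => x%:E) := iid'.
have mean : (\int[borel_law P]_x x%:E = mu%:E)%E := mean'.
have phiB : (\int[borel_law P]_x (phi (x - mu))%:E <= B%:E)%E := phiB'.
have cphimu : continuous (fun x => phi (x - mu)).
  move=> x; apply: continuous_comp; last exact: cphi.
  by apply: continuousB; [exact: cvg_id|exact: cvg_cst].
have mphi : measurable_fun [set: R] (fun x : R => phi (x - mu)).
  exact: continuous_measurable_fun.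
have iphi : (borel_law P).-integrable setT (fun x : R => (phi (x - mu))%:E).
  apply/integrableP; split; first exact/measurable_EFinP.
  under eq_integral do rewrite gee0_abs ?lee_fin//.
  exact: le_lt_trans phiB (ltry _).
have ic : (borel_law P).-integrable setT (fun=> c%:E : \bar R).
  by apply: finite_measure_integrable_cst.
have il : (borel_law P).-integrable setT (fun x : R => (l%:E * (phi (x - mu))%:E)%E).
  exact: integrableZl.
have is_ : (borel_law P).-integrable setT (fun x : R => (s%:E * x%:E)%E).
  exact: integrableZl.
under eq_integral do rewrite EFinD EFinD !EFinM.
rewrite integralD//; last exact: integrableD.
rewrite integralD// !integralZl// integral_cst//.
rewrite [X in (c%:E * X)%E](_ : _ = 1%E) ?mule1 ?mean; last exact: probability_setT.
rewrite EFinD EFinM EFinD EFinM.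
by apply: leeD => //; apply: leeD => //; exact: lee_wpmul2l.
Qed.

(* Weak duality: the test functions [c + l * phi (x + Delta) + k * x] and
   [c + l * phi (x - Delta) - k * x] have product at least 1, because each
   side of the origin reduces to [(w + k x) * (w - k x) >= 1]. *)
Lemma moment_class_affinity_le (R : realType) (phi : R -> R) (B Delta c l k : R)
    (P Q : probability (measurableTypeR R) R) :
  (forall x, 0 <= phi x) -> (forall x, phi (- x) = phi x) -> continuous phi ->
  {in `[0, +oo[ &, {homo phi : x y / x <= y}} ->
  0 <= Delta -> 0 <= c -> 0 <= l -> 0 <= k ->
  (forall y, 0 <= y -> 1 + (k * (y + Delta)) ^+ 2 <= (c + l * phi y) ^+ 2) ->
  moment_class phi B (- Delta) P -> moment_class phi B Delta Q ->
  hellinger_affinity P Q <= c + l * B - k * Delta.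
Proof.
move=> phi0 phiN cphi phiH D0 c0 l0 k0 cert CP CQ.
pose u x := c + l * phi (x - - Delta) + k * x.
pose v x := c + l * phi (x - Delta) + - k * x.
have cu (e s : R) : continuous (fun x : R => c + l * phi (x - e) + s * x).
  move=> x; apply: cvgD; last by apply: cvgM; [exact: cvg_cst|exact: cvg_id].
  apply: cvgD; first exact: cvg_cst.
  apply: cvgM; first exact: cvg_cst.
  apply: (@continuous_comp _ _ _ (fun x => x - e) phi); last exact: cphi.
  by apply: cvgB; [exact: cvg_id|exact: cvg_cst].
have mu (e s : R) : measurable_fun [set: measurableTypeR R]
    (fun x : R => c + l * phi (x - e) + s * x).
  exact: continuous_measurable_fun.
have mu' (e s : R) : measurable_fun [set: R]
    (fun x : R => c + l * phi (x - e) + s * x).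
  exact: continuous_measurable_fun.
have phiabs x : phi `|x| = phi x by case: (ger0P x) => // _; rewrite phiN.
have phile x y : `|x| <= `|y| -> phi x <= phi y.
  by rewrite -(phiabs x) -(phiabs y) => xy; apply: phiH => //; rewrite in_itv/= normr_ge0.
have uN x : u (- x) = v x.
  by rewrite /u /v opprK -(phiN (x - Delta)) opprB addrC [Delta - x]addrC; ring.
have half x : 0 <= x -> [/\ 0 <= v x, 1 <= u x * v x & v x <= u x].
  move=> x0.
  (* The constraint is used at [y = |x - Delta|]. As [x <= y + Delta], it gives [1 + (k x)^2 <= w^2]
     with [w = c + l phi (x - Delta)]; then [v x = w - k x] and [u x >= w + k x]. *)
  have := cert `|x - Delta| (normr_ge0 _); rewrite phiabs.
  have lphi : l * phi (x - Delta) <= l * phi (x + Delta).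
    apply: ler_wpM2l => //; apply: phile; rewrite (ger0_norm (addr_ge0 x0 D0)).
    by rewrite ler_norml; apply/andP; split; lra.
  have w0 : 0 <= c + l * phi (x - Delta) by rewrite addr_ge0// mulr_ge0.
  have xy : x <= `|x - Delta| + Delta by rewrite -lerBlDr ler_norm.
  have kx0 : 0 <= k * x by rewrite mulr_ge0.
  have : k * x <= k * (`|x - Delta| + Delta) by rewrite ler_wpM2l.
  rewrite /u /v opprK mulNr.
  have wlphi : c + l * phi (x - Delta) <= c + l * phi (x + Delta) by rewrite lerD2l.
  move: wlphi w0.
  move: (c + l * phi (x - Delta)) (c + l * phi (x + Delta)) (k * (_ + Delta)).
  move=> w w' z ww' w0 xz cw.
  have : (k * x) ^+ 2 <= z ^+ 2 by rewrite ler_sqr ?nnegrE//; lra.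
  move: (k * x) kx0 xz => q q0 qz q2.
  have qw : q <= w by rewrite -(@ler_pXn2r _ 2)// ?nnegrE//; lra.
  split.
  - lra.
  - have : (w + q) * (w - q) <= (w' + q) * (w - q) by rewrite ler_wpM2r; lra.
    nra.
  - lra.
have uv x : [/\ 0 <= u x, 0 <= v x & 1 <= u x * v x].
  (* Reflection exchanges [u] and [v], so negative points reduce to [half]. *)
  have [x0|/ltW x0] := leP 0 x.
    by have [v0 uv1 vu] := half x x0; split=> //; exact: le_trans vu.
  have [] := half (- x) _; first by rewrite oppr_ge0.
  rewrite uN -uN opprK mulrC => u0 uv1 vu.
  by split=> //; exact: le_trans vu.
have intE (N : probability (measurableTypeR R) R) (f : R -> R) :
    measurable_fun [set: R] f -> (forall x, 0 <= f x) ->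
    (\int[N]_x (f x)%:E = \int[borel_law N]_x (f x)%:E)%E.
  move=> mf f0; rewrite ge0_integral_distribution//; last exact/measurable_EFinP.
apply: (@hellinger_affinity_le _ _ _ P Q u v).
- exact: mu.
- exact: mu.
- by move=> x; have [] := uv x.
- by move=> x; have [] := uv x.
- by move=> x; have [] := uv x.
rewrite !intE; first last.
- by move=> x; have [] := uv x.
- exact: mu'.
- by move=> x; have [] := uv x.
- exact: mu'.
apply: le_trans.
  apply: leeD; first exact: (moment_class_integral_le c k phi0 cphi l0 CP).
  exact: (moment_class_integral_le c (- k) phi0 cphi l0 CQ).
by rewrite -EFinD lee_fin; lra.
Qed.

(** Both two-point laws have mass [1 - m] at 0, which bounds the affinity below. Because
    [phi Delta = 0], this atom adds nothing to the moment, and the other one adds at most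
    [m phi a <= B]. *)
Lemma moment_class_affinity_ge (R : realType) (phi : R -> R) (B Delta a : R) :
  (forall x, 0 <= phi x) -> (forall x, phi (- x) = phi x) -> continuous phi ->
  {in `[0, +oo[ &, {homo phi : x y / x <= y}} ->
  0 <= Delta -> 0 < a -> Delta <= a -> Delta / a <= 1 -> phi Delta = 0 ->
  Delta / a * phi a <= B ->
  exists P Q, [/\ moment_class phi B (- Delta) P, moment_class phi B Delta Q &
    1 - Delta / a <= hellinger_affinity P Q].
Proof.
move=> phi0 phiN cphi phiH D0 a0 Da m1 phiD phiB; set m := Delta / a in m1 phiB *.
have m0 : 0 <= m by rewrite divr_ge0// ltW.
have m01 : 0 <= m <= 1 by rewrite m0.
have maE : m * a = Delta by rewrite divfK// gt_eqF.
have two b mu : b != 0 -> m * b = mu -> phi (b - mu) <= phi a -> phi (- mu) = 0 ->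
    exists2 P, moment_class phi B mu P & P [set 0] = (1 - m)%:E.
  move=> b0 mb phib phimu.
  have [P [P0 iP meanP fP]] := exists_two_point_law m01 b0.
  exists P => //; rewrite mb in meanP; split; [exact: iP|exact: meanP|].
  suff h : (\int[borel_law P]_x (phi (x - mu))%:E <= B%:E)%E by exact: h.
  rewrite fP//; last first.
    apply: continuous_measurable_fun => x.
    apply: (@continuous_comp _ _ _ (fun x => x - mu) phi); last exact: cphi.
    by apply: cvgB; [exact: cvg_id|exact: cvg_cst].
  rewrite lee_fin sub0r phimu mulr0 addr0.
  by apply: le_trans phiB; rewrite ler_wpM2l.
have phiaD : phi (a - Delta) <= phi a.
  by apply: phiH; rewrite ?in_itv/= ?andbT ?subr_ge0 ?(ltW a0)// gerBl.
have [P CP P0] : exists2 P, moment_class phi B (- Delta) P & P [set 0] = (1 - m)%:E.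
  apply: (two (- a)); rewrite ?oppr_eq0 ?gt_eqF ?mulrN ?maE// ?opprK//.
  by rewrite -phiN opprD !opprK.
have [Q CQ Q0] : exists2 Q, moment_class phi B Delta Q & Q [set 0] = (1 - m)%:E.
  by apply: (two a); rewrite ?gt_eqF ?phiN.
exists P, Q; split => //.
have m10 : 0 <= 1 - m by rewrite subr_ge0.
have mS0 : measurable [set (0 : measurableTypeR R)] by [].
exact: (hellinger_affinity_ge_set1 mS0 m10 P0 Q0).
Qed.

(** * Monotonicity and tangent bounds for slowly varying functions *)

Lemma is_derive_le (R : realType) (f df : R -> R) (x y : R) : x <= y ->
  (forall z, x <= z <= y -> is_derive z 1 f (df z)) ->
  (forall z, x <= z <= y -> 0 <= df z) -> f x <= f y.
Proof.
move=> xy fdf df0; have fdf' z : z \in `]x, y[ -> is_derive z 1 f (df z).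
  by rewrite in_itv/= => /andP[xz zy]; apply: fdf; rewrite !ltW.
have cf : {within `[x, y], continuous f}.
  apply: derivable_within_continuous => z; rewrite in_itv/= => xzy.
  exact: (@ex_derive _ _ _ _ _ _ _ (fdf z xzy)).
have [c] := MVT_segment xy fdf' cf; rewrite in_itv/= => xcy.
by rewrite -subr_ge0 => ->; rewrite mulr_ge0 ?subr_ge0 ?df0.
Qed.

(** Explicit form, beyond a threshold, of the limits of [eta] and [x eta' / eta]; [h] plays the role
    of [ln (Lambda / Lambda0)]. The factor 4 is what makes [x eta^4] nondecreasing and [L^4 / x]
    nonincreasing. *)
Record slow_variation (R : realType) (eta h : R -> R) (x1 : R) : Prop :=
  SlowVariation {
  sv_x1_ge1 : 1 <= x1 ;
  sv_eta_gt0 : forall x, x1 <= x -> 0 < eta x ;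
  sv_eta_le : forall x, x1 <= x -> eta x <= 4^-1 ;
  sv_deta : forall x, x1 <= x -> exists2 de : R,
    is_derive x 1 eta de & 4 * `|x * de| <= eta x ;
  sv_dh : forall x, x1 <= x -> is_derive x 1 h (eta x / x) }.

Section slow_variation.
Context {R : realType} (eta h : R -> R) (x1 : R).
Hypothesis sv : slow_variation eta h x1.

Let x_gt0 x : x1 <= x -> 0 < x.
Proof. by have := sv_x1_ge1 sv; lra. Qed.

(** The derivative is [eta^n (eta + (n + 1) z eta')], nonnegative since [n + 1 <= 4] and
    [4 |z eta'| <= eta]. *)
Lemma mul_eta_exp_ndecr (n : nat) (x y : R) : (n <= 3)%N -> x1 <= x -> x <= y ->
  x * eta x ^+ n.+1 <= y * eta y ^+ n.+1.
Proof.
move=> n3 x1x xy.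
pose de z := 'D_1 eta z.
have dez z : x1 <= z -> is_derive z 1 eta (de z) /\ 4 * `|z * de z| <= eta z.
  move=> /(sv_deta sv)[e ez ee]; suff -> : de z = e by [].
  exact: (@derive_val _ _ _ _ _ _ _ ez).
apply: (@is_derive_le _ (fun z => z * eta z ^+ n.+1)
  (fun z => eta z ^+ n.+1 + z * (n.+1%:R * eta z ^+ n * de z))) => //.
  move=> z /andP[xz zy]; have [dz _] := dez z (le_trans x1x xz).
  have -> : (fun u => u * eta u ^+ n.+1) = (id : R -> R) * (eta ^+ n.+1).
    by apply/funext => u; rewrite fctE exprfctE.
  apply: (is_derive_eq (is_deriveM (is_derive_id _ _) (is_deriveX n.+1 dz))).
  by rewrite /GRing.scale /= exprfctE mulr1 addrC.
move=> z /andP[xz zy]; have [_ de4] := dez z (le_trans x1x xz).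
have e0 := sv_eta_gt0 sv (le_trans x1x xz).
have n4 : n.+1%:R <= (4 : R) by rewrite ler_nat.
have zde : - eta z <= n.+1%:R * (z * de z).
  rewrite lerNl -mulrN (le_trans _ de4)//.
  apply: le_trans (ler_wpM2r (normr_ge0 _) n4); apply: ler_wpM2l => //.
  by rewrite -normrN ler_norm.
rewrite exprS.
have -> : eta z * eta z ^+ n + z * (n.+1%:R * eta z ^+ n * de z) =
  eta z ^+ n * (eta z + n.+1%:R * (z * de z)) by ring.
by rewrite mulr_ge0 ?exprn_ge0 ?(ltW e0)//; lra.
Qed.

Lemma h_ndecr (x y : R) : x1 <= x -> x <= y -> h x <= h y.
Proof.
move=> x1x xy; apply: (@is_derive_le _ h (fun z => eta z / z)) => // z /andP[xz _].
  by apply: (sv_dh sv); lra.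
have z1 : x1 <= z by lra.
by have ez := sv_eta_gt0 sv z1; have z0 := x_gt0 z1; rewrite divr_ge0 ?ltW.
Qed.

(** [h z + eta a * a / z] has derivative [(z eta z - a eta a) / z^2]. As [z eta z] is nondecreasing,
    this changes sign at [a], which is therefore a minimum. *)
Lemma h_ge_tangent (x a : R) : x1 <= x -> x1 <= a ->
  h a + eta a * (1 - a / x) <= h x.
Proof.
move=> x1x x1a; have a0 := x_gt0 x1a; have x0 := x_gt0 x1x.
pose g z := h z + eta a * (a / z).
pose dg z := eta z / z - eta a * a / z ^+ 2.
have dgP z : x1 <= z -> is_derive z 1 g (dg z).
  move=> z1; have z0 := x_gt0 z1; have := sv_dh sv z1 => dh.
  have dV : is_derive z 1 (fun y : R => y^-1) (- z ^- 2 *: 1).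
    by apply: (is_deriveV (f := id)); rewrite ?gt_eqF//; exact: is_derive_id.
  have -> : g = h + (eta a * a) \*: (fun y : R => y^-1).
    by apply/funext => u; rewrite /g mulrA.
  apply: (is_derive_eq (is_deriveD dh (is_deriveZ (eta a * a) dV))).
  by rewrite /dg /GRing.scale /= mulr1 mulrN.
have dgE z : x1 <= z -> dg z = (z * eta z ^+ 1 - a * eta a ^+ 1) / z ^+ 2.
  by move=> z1; rewrite /dg; field; rewrite gt_eqF// x_gt0.
suff : g a <= g x by rewrite /g divff ?gt_eqF//; lra.
have [xa|/ltW ax] := leP a x.
  apply: (@is_derive_le _ g dg) => // z /andP[az zx].
    by apply: dgP; lra.
  rewrite dgE; last lra.
  by rewrite divr_ge0 ?sqr_ge0// subr_ge0 mul_eta_exp_ndecr.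
rewrite -lerN2; apply: (@is_derive_le _ (- g) (fun z => - dg z)) => // z /andP[xz za].
  by have := dgP z (le_trans x1x xz) => ?; apply: is_deriveN.
rewrite dgE; last lra.
by rewrite -mulNr divr_ge0 ?sqr_ge0// opprB subr_ge0 mul_eta_exp_ndecr//; lra.
Qed.

(** Monotonicity of [z eta^2] gives [eta z <= eta a * sqrt (a / z)] for [z <= a]; integrating this
    against [dz / z] from [x] to [a] yields the bound. *)
Lemma h_le_sqrt (x a : R) : x1 <= x -> x <= a ->
  h a - h x <= 2 * eta a * Num.sqrt (a / x).
Proof.
move=> x1x xa; have x1a := le_trans x1x xa.
have a0 := x_gt0 x1a; have x0 := x_gt0 x1x; have e0 := sv_eta_gt0 sv x1a.
pose K := 2 * eta a * Num.sqrt a.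
pose g z := h z + K / Num.sqrt z.
pose dg z := eta z / z - eta a * Num.sqrt a / (z * Num.sqrt z).
have sqrt_neq0 (z : R) : 0 < z -> Num.sqrt z != 0 by move=> z0; rewrite gt_eqF ?sqrtr_gt0.
have dgP z : x1 <= z -> is_derive z 1 g (dg z).
  move=> z1; have z0 := x_gt0 z1; have := sv_dh sv z1 => dh.
  have ds := is_derive1_sqrt z0.
  have dV : is_derive z 1 (fun y : R => (Num.sqrt y)^-1)
     (- (Num.sqrt z) ^- 2 *: (2 * Num.sqrt z)^-1).
    exact: (@is_deriveV _ (@Num.sqrt R) z _ 1 (sqrt_neq0 _ z0) ds).
  apply: (is_derive_eq (is_deriveD dh (is_deriveZ K dV))).
  rewrite /dg /K /GRing.scale /= sqr_sqrtr ?(ltW z0)//; field.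
  by rewrite sqrt_neq0 ?gt_eqF.
suff : g a <= g x.
  rewrite /g /K mulfK ?sqrt_neq0// (sqrtrM _ (ltW a0)) sqrtrV ?(ltW x0)//.
  by rewrite mulrA; lra.
rewrite -lerN2; apply: (@is_derive_le _ (- g) (fun z => - dg z)) => // z /andP[xz za].
  by have := dgP z (le_trans x1x xz) => ?; apply: is_deriveN.
have z1 := le_trans x1x xz; have z0 := x_gt0 z1; have ez0 := sv_eta_gt0 sv z1.
have -> : - dg z = (eta a * Num.sqrt a - eta z * Num.sqrt z) / (z * Num.sqrt z).
  by rewrite /dg; field; rewrite sqrt_neq0 ?gt_eqF.
rewrite divr_ge0//; last by rewrite mulr_ge0 ?sqrtr_ge0 ?(ltW z0).
rewrite subr_ge0 -(@ler_pXn2r _ 2) ?nnegrE ?mulr_ge0 ?sqrtr_ge0 ?(ltW e0) ?(ltW ez0)//.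
rewrite !exprMn !sqr_sqrtr ?(ltW z0) ?(ltW a0)// mulrC [leRHS]mulrC.
exact: mul_eta_exp_ndecr.
Qed.

(** Since [eta <= 1/4], [ln - k h] is nondecreasing. The case [k = 1] makes [L x / x] nonincreasing;
    [k = 4] gives [L x ^ 4 = O(x)]. *)
Lemma h_le_ln (k : R) (x y : R) : 0 <= k -> k <= 4 -> x1 <= x -> x <= y ->
  k * (h y - h x) <= ln y - ln x.
Proof.
move=> k0 k4 x1x xy.
suff : ln x - k * h x <= ln y - k * h y by lra.
apply: (@is_derive_le _ (fun z => ln z - k * h z)
  (fun z => z^-1 - k * (eta z / z))) => // z /andP[xz _].
  have z1 := le_trans x1x xz; have z0 := x_gt0 z1.
  have := sv_dh sv z1 => dh; have dl := is_derive1_ln z0.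
  exact: is_deriveB dl (is_deriveZ k dh).
have z1 := le_trans x1x xz; have z0 := x_gt0 z1.
have e0 := sv_eta_gt0 sv z1; have e4 := sv_eta_le sv z1.
have -> : z^-1 - k * (eta z / z) = (1 - k * eta z) / z by field; rewrite gt_eqF.
have : k * eta z <= 4 * 4^-1 by apply: ler_pM => //; rewrite ltW.
by move=> kez; rewrite divr_ge0 ?(ltW z0)//; lra.
Qed.

End slow_variation.

(** * The scalar inequality behind the dual constraint, in three regimes *)

Section certificate_arith.
Context {R : realFieldType}.
Implicit Types d e p t z : R.

(** In all three regimes [z] stands for [kap (y + Delta)], [p] for [lam phi y] and [e] for the
    excess of [c] over 1. Here [2 e] alone pays for [z^2]. *)
Lemma certificate_near d e p z : 0 <= d <= 1 -> 0 <= e -> 0 <= p ->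
  z ^+ 2 <= 2 * e -> 1 + ((1 - d) * z) ^+ 2 <= (1 + e + (1 - d) * p) ^+ 2.
Proof.
move=> /andP[d0 d1] e0 p0 ze; have z2 := sqr_ge0 z.
have : ((1 - d) * z) ^+ 2 <= z ^+ 2.
  by rewrite exprMn ler_piMl// expr_le1//; lra.
have : 0 <= (1 - d) * p by rewrite mulr_ge0//; lra.
nra.
Qed.

(** The cross term [2 (1 - d) p] pays for [(1 - d)^2 z^2 <= (1 - d) z^2]. *)
Lemma certificate_middle d e p z : 0 <= d <= 1 -> 0 <= e ->
  z ^+ 2 <= 2 * p -> 1 + ((1 - d) * z) ^+ 2 <= (1 + e + (1 - d) * p) ^+ 2.
Proof.
move=> /andP[d0 d1] e0 zp; have z2 := sqr_ge0 z.
have d10 : 0 <= 1 - d by lra.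
have : ((1 - d) * z) ^+ 2 <= (1 - d) * z ^+ 2.
  by have := mulr_ge0 (mulr_ge0 d10 d0) z2; lra.
have : 0 <= (1 - d) * (2 * p - z ^+ 2) by rewrite mulr_ge0//; lra.
have : 0 <= (1 - d) * p by rewrite mulr_ge0//; lra.
nra.
Qed.

(* The squared inequality amounts to [(1 - d) (z - p) (z + p) <= 2 p]. *)
Lemma certificate_far d e p t z : 0 <= d <= 1 -> 0 <= e -> 0 <= p -> 0 <= z ->
  z - p <= t -> (1 - d) * t * z <= p ->
  1 + ((1 - d) * z) ^+ 2 <= (1 + e + (1 - d) * p) ^+ 2.
Proof.
move=> /andP[d0 d1] e0 p0 z0 zpt tzp.
have d10 : 0 <= 1 - d by lra.
have dp : 0 <= (1 - d) * p by rewrite mulr_ge0.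
apply: (@le_trans _ _ ((1 + (1 - d) * p) ^+ 2)); last first.
  by rewrite ler_sqr ?nnegrE//; lra.
suff : (1 - d) * ((1 - d) * ((z - p) * (z + p))) <= (1 - d) * (2 * p).
  by move=> h; nra.
apply: ler_wpM2l => //.
have [zp|pz] := leP z p.
  have : (1 - d) * ((z - p) * (z + p)) <= 0.
    by rewrite mulr_ge0_le0// mulr_le0_ge0//; lra.
  lra.
have : (z - p) * (z + p) <= t * (2 * z) by apply: ler_pM; lra.
move=> /(ler_wpM2l d10) h; apply: (le_trans h).
by rewrite [leLHS](_ : _ = 2 * ((1 - d) * t * z)); [lra|ring].
Qed.

End certificate_arith.

(** * Explicit dual multipliers and their feasibility for large [a] *)

Section certificate.
Context {R : realType} (eta h phi : R -> R) (x1 L0 : R).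
Hypothesis sv : slow_variation eta h x1.
Hypothesis L0_gt0 : 0 < L0.
Let L x := L0 * expR (h x).
Hypothesis phi_ge0 : forall x, 0 <= phi x.
Hypothesis phiE : forall x, x1 <= x -> phi x = x * L x.

Let L_gt0 x : 0 < L x. Proof. by rewrite mulr_gt0 ?expR_gt0. Qed.

Let L_ge (x a c : R) : c <= h x - h a -> L a * (1 + c) <= L x.
Proof.
move=> hc; have -> : L x = L0 * (expR (h a) * expR (h x - h a)).
  by rewrite -expRD addrC subrK.
rewrite /L -mulrA ler_pM2l//.
rewrite ler_pM2l ?expR_gt0//; apply: le_trans (expR_ge1Dx _); lra.
Qed.

Let L_ndecr (x y : R) : x1 <= x -> x <= y -> L x <= L y.
Proof. by move=> x1x xy; rewrite ler_pM2l// ler_expR (h_ndecr sv). Qed.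

Let L_div_nincr (x y : R) : x1 <= x -> x <= y -> L y / y <= L x / x.
Proof.
move=> x1x xy; have x11 := sv_x1_ge1 sv.
have x0 : 0 < x by lra. have y0 : 0 < y by lra.
rewrite ler_pdivrMr// mulrAC ler_pdivlMr// /L -!mulrA ler_pM2l//.
have := h_le_ln sv ler01 (ler1n _ 4) x1x xy; rewrite mul1r => hl.
rewrite -[X in _ * X <= _](@lnK _ x)// -[X in _ <= _ * X](@lnK _ y)//.
by rewrite -!expRD ler_expR; lra.
Qed.

Lemma dual_certificate (a B Delta d : R) :
  x1 <= a -> 0 < Delta -> Delta <= x1 -> L a * Delta = B -> 0 < d < 1 ->
  x1 <= a * eta a / 16 -> eta a <= d / 8 ->
  (1 + eta a) / (a * eta a) * Delta <= d / 8 ->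
  Delta <= d / 8 * (a * eta a / 16) -> 8 * Num.sqrt (eta a) <= d / 8 ->
  2 * ((1 + eta a) / (a * eta a)) ^+ 2 * x1 ^+ 2 <= d * (Delta / a) ->
  exists c l k, [/\ 0 <= c, 0 <= l, 0 <= k,
    forall y, 0 <= y -> 1 + (k * (y + Delta)) ^+ 2 <= (c + l * phi y) ^+ 2 &
    c + l * B - k * Delta <= 1 - (1 - 2 * d) * (Delta / a)].
Proof.
move=> x1a D0 Dx1 LB /andP[d0 d1].
have x11 := sv_x1_ge1 sv; have a0 : 0 < a by lra.
have e0 := sv_eta_gt0 sv x1a; have e4 := sv_eta_le sv x1a; have La0 := L_gt0 a.
have tangent y (x1y : x1 <= y) := h_ge_tangent sv x1y x1a; have hsqrt := h_le_sqrt sv.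
set e := eta a in e0 e4 tangent *.
have ae0 : 0 < a * e by rewrite mulr_gt0.
(* [xs] separates the middle and far regimes; [kap] and [lam] are the multipliers before the factor
   [1 - d]. *)
set xs := a * e / 16; set kap := (1 + e) / (a * e).
pose lam := (a * L a * e)^-1.
have kap0 : 0 < kap by apply: divr_gt0 => //; lra.
have lam0 : 0 < lam by rewrite invr_gt0 mulr_gt0 ?(mulr_gt0 a0 La0).
move=> x1xs ed kapD Dxs sqrted epsd.
(* Chosen so that [2 eps = (2 kap x1)^2], which bounds [z^2] when [y <= x1], as then
   [y + Delta <= 2 x1]. *)
set eps := 2 * kap ^+ 2 * x1 ^+ 2 in epsd.
have eps0 : 0 <= eps by rewrite mulr_ge0 ?sqr_ge0// mulr_ge0 ?sqr_ge0.
have d01 : 0 <= d <= 1 by lra.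
have xs0 : 0 < xs by rewrite /xs; lra.
(* Although [xs] is much smaller than [a], [L] hardly drops: [h a - h xs <= 2 e sqrt (a / xs) = 8
   sqrt e <= d / 8]. *)
have Lxs : L a * (1 - d / 8) <= L xs.
  have xsa : xs <= a by rewrite /xs; nra.
  apply: (@le_trans _ _ (L a * (1 + - (2 * e * Num.sqrt (a / xs))))); last first.
    by apply: L_ge; have := hsqrt _ _ x1xs xsa; rewrite -/e; lra.
  rewrite ler_pM2l//.
  suff -> : 2 * e * Num.sqrt (a / xs) = 8 * Num.sqrt e by lra.
  have -> : a / xs = 4 ^+ 2 / e by rewrite /xs; field; rewrite !gt_eqF.
  rewrite (sqrtrM _ (sqr_ge0 _)) sqrtr_sqr normr_nat sqrtrV ?(ltW e0)//.
  rewrite -{1}(sqr_sqrtr (ltW e0)); field.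
  by rewrite gt_eqF ?sqrtr_gt0.
exists (1 + eps), ((1 - d) * lam), ((1 - d) * kap); split.
- lra.
- by rewrite mulr_ge0 ?(ltW lam0)//; lra.
- by rewrite mulr_ge0 ?(ltW kap0)//; lra.
- move=> y y0; rewrite -(mulrA (1 - d) kap) -(mulrA (1 - d) lam).
  have p0 : 0 <= lam * phi y by rewrite mulr_ge0 ?(ltW lam0).
  have z0 : 0 <= kap * (y + Delta) by rewrite mulr_ge0 ?(ltW kap0)//; lra.
  have [yx1|/ltW x1y] := leP y x1.
    apply: certificate_near => //.
    have : kap * (y + Delta) <= kap * (2 * x1) by rewrite ler_pM2l//; lra.
    move=> zle; have : (kap * (y + Delta)) ^+ 2 <= (kap * (2 * x1)) ^+ 2.
      by rewrite ler_sqr ?nnegrE//; apply: le_trans zle.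
    by have -> : (kap * (2 * x1)) ^+ 2 = 2 * eps by rewrite /eps; ring.
  have [yxs|/ltW xsy] := leP y xs.
    apply: certificate_middle => //.
    have y_gt0 : 0 < y by lra.
    have Ly : 8 * L a / (a * e) <= L y / y.
      apply: le_trans (L_div_nincr x1y yxs).
      rewrite (_ : 8 * L a / _ = L a * 2^-1 / xs); last first.
        by rewrite /xs; field; rewrite !gt_eqF.
      rewrite ler_pM2r ?invr_gt0//; apply: le_trans Lxs.
      by rewrite ler_pM2l//; lra.
    (* From [1 + e <= 5/4] and [y + Delta <= 2 y], [z <= 5/2 * y / (a e)], while [Ly] gives
       [2 p >= 16 (y / (a e))^2]; and [25/4 <= 16]. *)
    apply: (@le_trans _ _ ((5 / 2 * (y / (a * e))) ^+ 2)).
      rewrite ler_sqr ?nnegrE//; last by rewrite mulr_ge0// divr_ge0// ltW.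
      rewrite /kap [leRHS](_ : _ = 5 / 4 / (a * e) * (2 * y)); last first.
        by field; rewrite !gt_eqF.
      apply: ler_pM; [exact: ltW|lra| |lra].
      by rewrite /kap ler_pM2r ?invr_gt0//; lra.
    rewrite phiE// /lam.
    have -> : 2 * ((a * L a * e)^-1 * (y * L y)) =
        2 * y ^+ 2 / (a * L a * e) * (L y / y).
      by field; rewrite !gt_eqF.
    apply: (@le_trans _ _ (2 * y ^+ 2 / (a * L a * e) * (8 * L a / (a * e)))).
      have -> : 2 * y ^+ 2 / (a * L a * e) * (8 * L a / (a * e)) =
        16 * (y / (a * e)) ^+ 2 by field; rewrite !gt_eqF.
      rewrite exprMn; have := sqr_ge0 (y / (a * e)); lra.
    have ale0 : 0 < a * L a * e by rewrite mulr_gt0 ?(mulr_gt0 a0 La0).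
    apply: ler_wpM2l Ly; apply: divr_ge0 (ltW ale0).
    exact: mulr_ge0 (sqr_ge0 y).
  have y_gt0 : 0 < y by lra.
  have pE : lam * phi y = y / (a * e) * (L y / L a).
    by rewrite phiE// /lam; field; rewrite !gt_eqF.
  (* The tangent bound reads [p >= kap y - 1], hence [z - p <= 1 + kap Delta]. *)
  apply: (@certificate_far _ _ _ _ (1 + kap * Delta)) => //.
    have /L_ge : e * (1 - a / y) <= h y - h a by have := tangent _ x1y; lra.
    rewrite mulrC -ler_pdivlMr// => Ly.
    have : y / (a * e) * (1 + e * (1 - a / y)) <= lam * phi y.
      by rewrite pE ler_pM2l// divr_gt0.
    have -> : y / (a * e) * (1 + e * (1 - a / y)) = kap * y - 1.
      by rewrite /kap; field; rewrite !gt_eqF.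
    lra.
  have Ly : 1 - d / 8 <= L y / L a.
    by rewrite ler_pdivlMr// mulrC; apply: le_trans Lxs (L_ndecr _ _).
  rewrite pE; apply: (@le_trans _ _ (y / (a * e) * (1 - d / 8))); last first.
    by rewrite ler_pM2l// divr_gt0.
  have D8 : Delta <= d / 8 * y by nra.
  (* Each of [1 + kap Delta], [1 + e] and [(y + Delta) / y] is at most [1 + d / 8], and
     [(1 - d) (1 + d / 8)^3 <= 1 - d / 8]. *)
  apply: (@le_trans _ _
    ((1 - d) * (1 + d / 8) * ((1 + d / 8) / (a * e) * ((1 + d / 8) * y)))).
    apply: ler_pM => //.
    - by rewrite mulr_ge0//; nra.
    - by rewrite ler_wpM2l//; lra.
    - apply: ler_pM; [exact: ltW|lra| |lra].
      by rewrite /kap ler_pM2r ?invr_gt0//; lra.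
  rewrite [leLHS](_ : _ = y / (a * e) * ((1 - d) * (1 + d / 8) ^+ 3)); last first.
    by field; rewrite !gt_eqF.
  by rewrite ler_pM2l ?divr_gt0//; nra.
rewrite (_ : _ - _ = 1 + eps - (1 - d) * (kap * Delta - lam * B)); last by ring.
have -> : kap * Delta - lam * B = Delta / a.
  by rewrite -LB /kap /lam; field; rewrite !gt_eqF.
lra.
Qed.

(** [a eta^4] stays above a constant [c > 0], so [a eta >= c / eta], which diverges. *)
Lemma near_mul_eta_ge (M : R) : eta x @[x --> +oo] --> 0 ->
  \forall a \near +oo, M <= a * eta a.
Proof.
move=> eta0; have x11 := sv_x1_ge1 sv.
have e10 := sv_eta_gt0 sv (lexx x1).
pose c := x1 * eta x1 ^+ 4; have c0 : 0 < c by rewrite mulr_gt0 ?exprn_gt0//; lra.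
have M0 : 0 < c / (`|M| + 1) by rewrite divr_gt0// ltr_wpDl.
near=> a.
have x1a : x1 <= a by near: a; apply: nbhs_pinfty_ge; exact: num_real.
have ea : eta a < c / (`|M| + 1).
  near: a; move: eta0 => /cvgrPdist_lt/(_ _ M0); apply: filterS => x.
  by rewrite sub0r normrN; apply: le_lt_trans; exact: ler_norm.
have a0 : 0 < a by lra.
have e0 := sv_eta_gt0 sv x1a; have e4 := sv_eta_le sv x1a.
have ca : c <= a * eta a ^+ 4 := mul_eta_exp_ndecr sv (leqnn 3) (lexx x1) x1a.
have ea3 : eta a ^+ 3 <= eta a.
  by rewrite exprSr ler_piMl ?(ltW e0)// expr_le1// ?(ltW e0)//; lra.
have ca' : c <= (a * eta a) * eta a.
  apply: le_trans ca _; rewrite exprS mulrA ler_wpM2l//.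
  by rewrite ltW// mulr_gt0.
have : c < (`|M| + 1)^-1 * c * (a * eta a).
  apply: (le_lt_trans ca'); rewrite mulrC ltr_pM2r ?mulr_gt0//.
  by rewrite mulrC.
rewrite mulrAC -{1}(mul1r c) ltr_pM2r// mulrC ltr_pdivlMr ?mul1r ?ltr_wpDl//.
by have := ler_norm M; lra.
Unshelve. all: by end_near. Qed.

(** [L a ^ 4 <= C a], whereas [(a eta^2)^4 = a^2 (a eta^4)^2 >= c^2 a^2]. This makes [eps]
    negligible against [m]: their ratio is of order [L a / (a eta^2)]. *)
Lemma near_L_le (M : R) : 0 < M ->
  \forall a \near +oo, L a <= M * (a * eta a ^+ 2).
Proof.
move=> M0; have x11 := sv_x1_ge1 sv; have x10 : 0 < x1 by lra.
have e10 := sv_eta_gt0 sv (lexx x1).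
pose c := x1 * eta x1 ^+ 4; have c0 : 0 < c by rewrite mulr_gt0 ?exprn_gt0//; lra.
pose C := L x1 ^+ 4 / x1.
near=> a.
have x1a : x1 <= a by near: a; apply: nbhs_pinfty_ge; exact: num_real.
have Ca : C / (M ^+ 4 * c ^+ 2) <= a by near: a; apply: nbhs_pinfty_ge; exact: num_real.
have a0 : 0 < a by lra.
have e0 := sv_eta_gt0 sv x1a.
have ca : c <= a * eta a ^+ 4 := mul_eta_exp_ndecr sv (leqnn 3) (lexx x1) x1a.
have LC : L a ^+ 4 <= C * a.
  have hx : expR (h a) ^+ 4 * x1 <= expR (h x1) ^+ 4 * a.
    rewrite -!expRM_natl -[X in _ * X <= _](@lnK _ x1)// -[X in _ <= _ * X](@lnK _ a)//.
    rewrite -!expRD ler_expR.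
    by have := h_le_ln sv (ler0n _ 4) (lexx 4) (lexx x1) x1a; lra.
  rewrite /C mulrAC ler_pdivlMr// /L (exprMn _ L0) (exprMn _ L0).
  by rewrite -(mulrA (L0 ^+ 4)) -(mulrA (L0 ^+ 4)) ler_pM2l ?exprn_gt0.
rewrite -(@ler_pXn2r _ 4)// ?nnegrE ?(ltW (L_gt0 _))//; last first.
  by rewrite !mulr_ge0 ?exprn_ge0 ?(ltW e0) ?(ltW a0) ?(ltW M0).
apply: (le_trans LC); rewrite ler_pdivrMr in Ca; last by rewrite mulr_gt0 ?exprn_gt0.
apply: (@le_trans _ _ (a * (M ^+ 4 * c ^+ 2) * a)); first by rewrite ler_pM2r.
have -> : (M * (a * eta a ^+ 2)) ^+ 4 =
  a * (M ^+ 4 * (a * eta a ^+ 4) ^+ 2) * a by ring.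
rewrite ler_pM2r// ler_pM2l// ler_pM2l ?exprn_gt0// ler_sqr ?nnegrE ?(ltW c0)//.
exact: le_trans (ltW c0) ca.
Unshelve. all: by end_near. Qed.

Lemma near_dual_certificate (B d : R) : 0 < B -> 0 < d < 1 ->
  eta x @[x --> +oo] --> 0 ->
  \forall a \near +oo, forall Delta, 0 < Delta -> Delta <= 1 ->
  L a * Delta = B ->
  exists c l k, [/\ 0 <= c, 0 <= l, 0 <= k,
    forall y, 0 <= y -> 1 + (k * (y + Delta)) ^+ 2 <= (c + l * phi y) ^+ 2 &
    c + l * B - k * Delta <= 1 - (1 - 2 * d) * (Delta / a)].
Proof.
move=> B0 /andP[d0 d1] eta0; have x11 := sv_x1_ge1 sv.
(* [eta a < t] yields [8 sqrt (eta a) <= d / 8]; [q] is set so that [d B = 4 (2 x1^2 q)], where 4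
   bounds [(1 + eta a)^2]. *)
pose t := (d / 64) ^+ 2; have t0 : 0 < t by rewrite exprn_gt0//; lra.
pose q := d * B / (8 * x1 ^+ 2).
have x10 : 0 < x1 by lra.
have x120 : 0 < x1 ^+ 2 by rewrite exprn_gt0.
have q0 : 0 < q by rewrite divr_gt0 ?mulr_gt0.
near=> a => Delta D0 D1 LB.
have x1a : x1 <= a by near: a; apply: nbhs_pinfty_ge; exact: num_real.
have et : eta a < t.
  near: a; move: eta0 => /cvgrPdist_lt/(_ _ t0); apply: filterS => x.
  by rewrite sub0r normrN; apply: le_lt_trans; exact: ler_norm.
(* The term [16 x1] puts [xs] beyond [x1]; [128 / d] gives [Delta <= 1 <= d / 8 * xs] and bounds
   [kap] by [d / 8]. *)
have aeM : 16 * x1 + 128 / d <= a * eta a by near: a; exact: near_mul_eta_ge.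
have LM : L a <= q * (a * eta a ^+ 2) by near: a; exact: near_L_le.
have a0 : 0 < a by lra.
have e0 := sv_eta_gt0 sv x1a; have e4 := sv_eta_le sv x1a; have La0 := L_gt0 a.
have ae0 : 0 < a * eta a by rewrite mulr_gt0.
have d80 : 0 < 128 / d by rewrite divr_gt0.
have aed : 128 <= d * (a * eta a).
  by rewrite mulrC -ler_pdivrMr//; lra.
apply: (@dual_certificate a B Delta d) => //.
- lra.
- by rewrite d0.
- lra.
- by apply: (le_trans (ltW et)); rewrite /t; nra.
- apply: (@le_trans _ _ ((1 + eta a) / (a * eta a))).
    by rewrite ler_piMr// divr_ge0 ?(ltW ae0)//; lra.
  by rewrite ler_pdivrMr//; lra.
- lra.
- have : Num.sqrt (eta a) <= d / 64; last lra.
  have d640 : 0 <= d / 64 by lra.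
  by rewrite -(ger0_norm d640) -sqrtr_sqr ler_wsqrtr// ltW.
have -> : d * (Delta / a) = d * B / (a * L a).
  by rewrite -LB; field; rewrite (gt_eqF a0) (gt_eqF La0).
rewrite ler_pdivlMr ?(mulr_gt0 a0 La0)//.
have -> : 2 * ((1 + eta a) / (a * eta a)) ^+ 2 * x1 ^+ 2 * (a * L a) =
  (1 + eta a) ^+ 2 * (2 * x1 ^+ 2 * (L a / (a * eta a ^+ 2))).
  by field; rewrite !gt_eqF.
have LM' : L a / (a * eta a ^+ 2) <= q by rewrite ler_pdivrMr// mulr_gt0 ?exprn_gt0.
have qE : d * B = 4 * (2 * x1 ^+ 2 * q) by rewrite /q; field; rewrite gt_eqF.
rewrite qE; apply: ler_pM.
- exact: sqr_ge0.
- apply: mulr_ge0; first by rewrite mulr_ge0 ?(ltW x120).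
  by rewrite divr_ge0 ?(ltW La0)// mulr_ge0 ?(ltW a0)// sqr_ge0.
- by nra.
- by rewrite ler_pM2l ?(mulr_gt0 _ x120).
Unshelve. all: by end_near. Qed.

End certificate.

(** * From the integral representation to explicit slow variation *)

Section representation.
Context {R : realType} (phi eta deta : R -> R) (xoo : R).
Hypothesis xoo1 : 1 < xoo.
Hypothesis etaC1 : C1_on_half_line xoo eta deta.

Lemma is_derive_C1 (x : R) : xoo < x -> is_derive x 1 eta (deta x).
Proof.
move=> xx; have [/(_ x (ltW xx)) + _] := etaC1.
move=> q; suff q' : h^-1 *: (eta (h *: 1 + x) - eta x) @[h --> (0:R)^'] --> deta x.
  apply: DeriveDef; first by apply/cvg_ex; exists (deta x); exact: q'.
  exact/cvg_lim.
apply/cvgrPdist_lt => e e0.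
move: q => /cvgrPdist_lt/(_ e e0).
rewrite /within/= => /nbhs_ballP[r /= r0 rP].
(* Steps shorter than [x - xoo] stay in the half-line, so the restricted difference quotient is the
   ordinary one. *)
apply/nbhs_ballP; exists (Num.min r (x - xoo)) => /=.
  by rewrite lt_min r0 subr_gt0.
move=> h; rewrite /ball /= sub0r normrN lt_min => /andP[hr hx] hneq0.
have := rP (h + x); rewrite /ball/= opprD addrCA subrr addr0 normrN hr.
have hx0 : h + x != x by rewrite -subr_eq0 addrK.
have xh : h + x \in `[xoo, +oo[.
  rewrite in_itv/= andbT; move: hx; rewrite ltr_norml => /andP[]; lra.
move=> /(_ isT hx0 xh); rewrite addrK => H.
by rewrite /GRing.scale /= mulr1 [h^-1 * _]mulrC.
Qed.

(** Endpoint continuity, needed to integrate [eta u / u] from [xoo] itself: [eta y] is [eta xoo]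
    plus the convergent difference quotient times [y - xoo]. *)
Lemma cvg_at_right_C1 : eta x @[x --> xoo^'+] --> eta xoo.
Proof.
have [/(_ xoo (lexx _)) q _] := etaC1.
have q' : (eta y - eta xoo) / (y - xoo) @[y --> xoo^'+] --> deta xoo.
  apply/cvgrPdist_lt => e e0; move: q => /cvgrPdist_lt/(_ e e0).
  rewrite /within/= => /nbhs_ballP[r /= r0 rP].
  near=> y; have yx : xoo < y by near: y; exact: nbhs_right_gt.
  have yr : y < xoo + r by near: y; apply: nbhs_right_lt; rewrite ltrDl.
  apply: rP; rewrite ?gt_eqF// ?in_itv/= ?(ltW yx)//.
  by rewrite /ball/= distrC gtr0_norm; lra.
have d0 : y - xoo @[y --> xoo^'+] --> xoo - xoo.
  apply: (@cvg_at_right_filter _ _ (fun y => y - xoo)).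
  by apply: cvgB; [exact: cvg_id|exact: cvg_cst].
have h := cvgD (cvgM q' d0) (cvg_cst (eta xoo)).
rewrite subrr mulr0 add0r in h.
have heq : {near xoo^'+, (fun y => (eta y - eta xoo) / (y - xoo) * (y - xoo) +
    eta xoo) =1 eta}.
  near=> y; have yx : y - xoo != 0.
    by rewrite subr_eq0 gt_eqF//; near: y; exact: nbhs_right_gt.
  by rewrite divfK// subrK.
have g := near_eq_cvg heq.
exact: (cvg_trans (g _) (h _ _ _)).
Unshelve. all: by end_near. Qed.

Let integrand u := eta u / u.

Lemma continuous_integrand (x : R) : xoo < x -> {for x, continuous integrand}.
Proof.
move=> xx; have dx := is_derive_C1 xx.
apply: cvgM.
  by apply: differentiable_continuous; apply/derivable1_diffP; exact: ex_derive.
have x0 : x != 0 by apply: lt0r_neq0; exact: lt_trans (lt_trans ltr01 xoo1) xx.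
by apply: cvgV => //; exact: cvg_id.
Qed.

Lemma integrable_integrand (b : R) : xoo < b ->
  lebesgue_measure.-integrable `[xoo, b] (EFin \o integrand).
Proof.
move=> xb; apply: continuous_compact_integrable; first exact: segment_compact.
apply/(continuous_within_itvP _ xb); split.
- by move=> x; rewrite in_itv/= => /andP[xx _]; exact: continuous_integrand.
- apply: cvgM; first exact: cvg_at_right_C1.
  have x0 : xoo != 0 by apply: lt0r_neq0; exact: lt_trans ltr01 xoo1.
  apply: (@cvg_at_right_filter _ _ (fun y : R => y^-1)).
  by apply: cvgV => //; exact: cvg_id.
- by apply: cvg_at_left_filter; exact: continuous_integrand.
Qed.

Lemma is_derive_integral (x : R) : xoo < x ->
  is_derive x 1 (fun x => \int[lebesgue_measure]_(u in `[xoo, x]) (eta u / u))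
    (eta x / x).
Proof.
move=> xx; have xx1 : x < x + 1 by lra.
have [d dE] := continuous_FTC1_closed xx1 (integrable_integrand (lt_trans xx xx1)) xx
  (continuous_integrand xx).
by apply: DeriveDef => //; rewrite -derive1E.
Qed.

End representation.

Lemma exists_slow_variation (R : realType) (phi : R -> R) (xoo L0 : R)
    (eta : R -> R) :
  slowly_varying_representation phi xoo L0 eta ->
  exists2 x1, xoo <= x1 & slow_variation eta
    (fun x => \int[lebesgue_measure]_(u in `[xoo, x]) (eta u / u)) x1.
Proof.
move=> [xoo1 L00 eta0 _ etacvg _ [deta [C1 detacvg]]].
have e1 : (0 : R) < 4^-1 by rewrite invr_gt0.
move: etacvg => /cvgrPdist_lt/(_ _ e1)[M1 [_ M1P]].
move: detacvg => /cvgrPdist_lt/(_ _ e1)[M2 [_ M2P]].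
(* The added 1 puts [x1] strictly beyond [xoo], where derivatives are two-sided. *)
pose x1 := Num.max (Num.max M1 M2) xoo + 1.
have x1P x : x1 <= x -> [/\ M1 < x, M2 < x & xoo < x].
  rewrite /x1 => x1x; have : Num.max (Num.max M1 M2) xoo < x by lra.
  by rewrite !gt_max -andbA => /and3P[].
exists x1; first by have [] := x1P x1 (lexx _); lra.
split.
- by have [] := x1P x1 (lexx _); lra.
- by move=> x /x1P[_ _ xx]; apply: eta0; exact: ltW.
- move=> x /x1P[/M1P + _ _] /=; rewrite sub0r normrN => h.
  by apply: le_trans (ltW h); exact: ler_norm.
- move=> x /x1P[_ /M2P + xx] /=; rewrite sub0r normrN => h.
  exists (deta x); first exact: is_derive_C1 xx.
  have ex0 : 0 < eta x by apply: eta0; exact: ltW.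
  move: h; rewrite normrM normfV [`|eta x|]gtr0_norm// ltr_pdivrMr//; lra.
- by move=> x /x1P[_ _ xx]; exact: (is_derive_integral xoo1 C1).
Qed.

(** The pseudo-inverse returns a true preimage once [B / Delta] is attained, which follows from
    continuity and divergence of [Lambda phi]. On [[xoo, M']], [Lambda phi] stays below
    [K < B / Delta], so the preimage lies beyond [M']. *)
Lemma near_a_ge (R : realType) (phi : R -> R) (B xoo L0 : R) (eta : R -> R) (M : R) :
  slowly_varying_moment_class phi B xoo L0 eta ->
  \forall Delta \near 0^'+, M <= a_ phi B xoo Delta /\
    Lambda phi (a_ phi B xoo Delta) * Delta = B.
Proof.
move=> [phi0 _ cphi phiH phiy _ phi0B _ [xoo1 _ _ _ _ _ _]].
have B0 : 0 < B by apply: le_lt_trans phi0B.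
pose M' := Num.max M xoo; pose K := phi M' + 1.
have K0 : 0 < K by rewrite ltr_wpDl.
have xM' : xoo <= M' by rewrite le_max lexx orbT.
have LK x : xoo <= x -> x <= M' -> Lambda phi x < K.
  move=> xx xM; have x1 : 1 <= x by lra.
  rewrite /Lambda ger0_norm; last lra.
  rewrite ltr_pdivrMr; last lra.
  have : phi x <= phi M' by apply: phiH; rewrite ?in_itv/= ?andbT//; lra.
  have := phi0 M'; rewrite /K; nra.
have cL x : 1 <= x -> {for x, continuous (Lambda phi)}.
  move=> x1; apply: cvgM; first exact: cphi.
  apply: cvgV; last exact: norm_continuous.
  by rewrite normr_eq0 lt0r_neq0//; apply: lt_le_trans x1.
near=> Delta.
have D0 : 0 < Delta by near: Delta; exact: nbhs_right_gt.
have DK : Delta < B / K by near: Delta; apply: nbhs_right_lt; rewrite divr_gt0.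
have KBD : K < B / Delta by rewrite ltr_pdivlMr// mulrC -ltr_pdivlMr.
set y := B / Delta in KBD *.
have surjL : set_surj `[xoo, +oo[ [set y] (Lambda phi).
  move=> _ /= ->.
  have [A [_ AP]] : \forall x \near +oo, y <= Lambda phi x.
    by move: phiy => /cvgryPge/(_ y).
  pose N := Num.max A M' + 1.
  have NM : M' <= N.
    by rewrite /N; have : M' <= Num.max A M'; [rewrite le_max lexx orbT|lra].
  have AN : A < N.
    by rewrite /N; have : A <= Num.max A M'; [rewrite le_max lexx|lra].
  have LN := AP N AN; have LM := LK M' xM' (lexx _).
  have cLN : {within `[M', N], continuous (Lambda phi)}.
    apply: continuous_in_subspaceT => x; rewrite inE/= in_itv/= => /andP[M'x _].
    by apply: cL; lra.
  have [] := IVT (v := y) NM cLN.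
    by rewrite ge_min le_max LN (ltW (lt_trans LM KBD)) orbT.
  move=> c; rewrite in_itv/= => /andP[M'c _] Lc; exists c => //=.
  by rewrite in_itv/= andbT; lra.
have yL : Lambda phi (a_ phi B xoo Delta) = y.
  by rewrite /a_ (surjpK _ surjL)// inE.
have : xoo <= a_ phi B xoo Delta.
  have /(_ (a_ phi B xoo Delta)) := @surjpinv_image_sub _ _ (fun=> 0) _ _ _ surjL.
  by rewrite /= in_itv/= andbT; apply; exists y.
rewrite yL divfK ?gt_eqF// => xa; split=> //.
have [Ma|aM] := leP M' (a_ phi B xoo Delta).
  by apply: le_trans Ma; rewrite le_max lexx.
by have := LK _ xa (ltW aM); rewrite yL; lra.
Unshelve. all: by end_near. Qed.

(** * Two-sided bounds on [r_] and the limit *)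

Lemma ln_le_sub1 (R : realType) (x : R) : 0 < x -> ln x <= x - 1.
Proof.
move=> x0; have -> : ln x = ln (1 + (x - 1)) by congr ln; ring.
by apply: le_ln1Dx; lra.
Qed.

(** With the supremum [s] in [[1 - m, 1 - t m]], apply [ln x <= x - 1] to [s] for the lower bound
    and to [1 / s] for the upper one. *)
Lemma r_bounds (R : realType) (phi : R -> R) (B Delta m t : R) :
  0 < m -> m < 1 ->
  (exists P Q, [/\ moment_class phi B (- Delta) P, moment_class phi B Delta Q &
    1 - m <= hellinger_affinity P Q]) ->
  (forall P Q, moment_class phi B (- Delta) P -> moment_class phi B Delta Q ->
    hellinger_affinity P Q <= 1 - t * m) ->
  t * m <= r_ phi B Delta <= m / (1 - m).
Proof.
move=> m0 m1 [P [Q [CP CQ PQ]]] ub.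
rewrite /r_; set S := (X in sup X).
have Sub : ubound S (1 - t * m) by move=> _ [P' CP' [Q' CQ' <-]]; exact: ub.
have SPQ : S (hellinger_affinity P Q) by exists P => //; exists Q.
have supge : 1 - m <= sup S.
  by apply: le_trans PQ _; apply: ub_le_sup SPQ; exists (1 - t * m).
have suple : sup S <= 1 - t * m.
  by apply: ge_sup => //; exists (hellinger_affinity P Q).
have sup0 : 0 < sup S by lra.
apply/andP; split; first by have := ln_le_sub1 sup0; lra.
rewrite -lnV//; apply: le_trans (ln_le_sub1 _) _; first by rewrite invr_gt0.
have -> : m / (1 - m) = (1 - m)^-1 - 1 by field; lra.
by rewrite lerD2r lef_pV2// posrE; lra.
Qed.

Theorem theorem3 (R : realType) (phi : R -> R) (B xoo Lambda0 : R)
    (eta : R -> R) :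
  slowly_varying_moment_class phi B xoo Lambda0 eta ->
  r_ phi B Delta / m_ phi B xoo Delta @[Delta --> 0^'+] --> (1 : R).
Proof.
move=> H; have [phi0 phiN cphi phiH phiy _ phi0B [x0 [x00 phix0]] rep] := H.
have B0 : 0 < B by apply: le_lt_trans phi0B.
have [x1 xoo1 sv] := exists_slow_variation rep.
have x11 := sv_x1_ge1 sv.
set h := fun x => \int[lebesgue_measure]_(u in `[xoo, x]) (eta u / u) in sv.
have LE x : xoo <= x -> Lambda phi x = Lambda0 * expR (h x) by apply: svr_LambdaE rep _.
have phiL x : 0 < x -> phi x = x * Lambda phi x.
  by move=> x_gt0; rewrite /Lambda gtr0_norm// mulrC divfK// gt_eqF.
have phiE x : x1 <= x -> phi x = x * (Lambda0 * expR (h x)).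
  by move=> x1x; rewrite -LE; [apply: phiL; lra|lra].
apply/cvgrPdist_le => e e0.
(* [d <= e / 2] gives [1 - 2 d >= 1 - e]; with [m <= Delta < d <= 1/2] it also gives
   [1 / (1 - m) <= 1 + e]. *)
pose d := Num.min (e / 2) 2^-1.
have d0 : 0 < d by rewrite lt_min; apply/andP; split; lra.
have de : 2 * d <= e by have : d <= e / 2; [rewrite ge_min lexx|lra].
have d12 : d <= 2^-1 by rewrite ge_min lexx orbT.
have d01 : 0 < d < 1 by lra.
have [A [_ AP]] := near_dual_certificate sv (svr_Lambda0_gt0 rep) phi0 phiE B0 d01
  (svr_eta_cvg0 rep).
near=> Delta.
have D0 : 0 < Delta by near: Delta; exact: nbhs_right_gt.
have Dx0 : Delta < x0 by near: Delta; exact: nbhs_right_lt.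
have Dd : Delta < d by near: Delta; exact: nbhs_right_lt.
have [aM aB] : Num.max A x1 + 1 <= a_ phi B xoo Delta /\
    Lambda phi (a_ phi B xoo Delta) * Delta = B by near: Delta; exact: near_a_ge H.
rewrite /m_; set a := a_ phi B xoo Delta in aM aB *; set m := Delta / a.
have Aa : A < a by have : A <= Num.max A x1; [rewrite le_max lexx|lra].
have x1a : x1 < a by have : x1 <= Num.max A x1; [rewrite le_max lexx orbT|lra].
have a0 : 0 < a by lra.
have m0 : 0 < m by rewrite divr_gt0.
have mD : m <= Delta by rewrite ler_pdivrMr// ler_peMr; lra.
have D1 : Delta <= 1 by lra.
have LaB : Lambda0 * expR (h a) * Delta = B by rewrite -LE//; lra.
have [c [l [k [c0 l0 k0 cert clk]]]] := AP a Aa Delta D0 D1 LaB.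
have /andP[lo hi] : (1 - 2 * d) * m <= r_ phi B Delta <= m / (1 - m).
  apply: r_bounds => //; first lra.
    apply: moment_class_affinity_ge => //; try lra.
    - by rewrite -/m; lra.
    - by apply: phix0; rewrite gtr0_norm// ltW.
    (* By the choice of [a], the moment bound [Delta / a * phi a <= B] is an equality. *)
    - have -> : Delta / a * phi a = Lambda phi a * Delta.
        by rewrite phiL//; field; rewrite gt_eqF.
      by rewrite aB.
  move=> P Q CP CQ; apply: le_trans clk.
  by apply: moment_class_affinity_le CP CQ => //; exact: ltW.
rewrite ler_distlC; apply/andP; split.
  by rewrite ler_pdivlMr//; apply: le_trans lo; rewrite ler_pM2r//; lra.
rewrite ler_pdivrMr//; apply: (le_trans hi).
by rewrite mulrC ler_pM2r// -[leLHS]mul1r ler_pdivrMr; [nra|lra].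
Unshelve. all: by end_near. Qed.
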